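(* Let $2\le q<\infty$, let $\mu$ be a positive regular Borel measure on $\mathbb{C}_+$, and assume that $\mathcal{L}\colon L^\infty(0,\infty)\to L^q(\mathbb{C}_+,d\mu)$ is bounded. Then there exists an $N$-function $\Phi\colon[0,\infty)\to[0,\infty)$ for which $\mathcal{L}\colon L^\Phi(0,\infty)\to L^q(\mathbb{C}_+,d\mu)$ is bounded.
   Context: $\mathbb{C}_+=\{z\in\mathbb{C}:\operatorname{Re}z>0\}$. The Laplace transform of a function $f$ on $(0,\infty)$ is $\mathcal{L}f(z)=\int_0^\infty e^{-zt}f(t)\,dt$, $z\in\mathbb{C}_+$. A Young function is a function $\Phi\colon[0,\infty)\to[0,\infty]$ of the form $\Phi(t)=\int_0^t\phi(s)\,ds$, where $\phi\colon[0,\infty)\to[0,\infty]$ is nondecreasing, left-continuous, and neither constantly $0$ nor constantly $+\infty$. An $N$-function is a real-valued (finite) Young function $\Phi$ with $\lim_{x\to0}\Phi(x)/x=\lim_{x\to\infty}x/\Phi(x)=0$. For an interval $J\subseteq\mathbb{R}$, $L^\Phi(J)$ is the space of measurable $f\colon J\to\mathbb{C}$ for which $\Phi(k^{-1}|f|)$ is integrable for some $k>0$, with norm $\|f\|_{L^\Phi}=\inf\{k>0:\int_J\Phi(k^{-1}|f(s)|)\,ds\le1\}$. *)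

(* Defs.v *)
(* MathComp-Analysis, with the complex numbers R[i] of mathcomp-real-closed. *)
From HB Require Import structures.
From mathcomp Require Import all_boot all_order all_algebra.
From mathcomp Require Import all_classical all_reals all_analysis.
From mathcomp Require Import complex.

Set Implicit Arguments.
Unset Strict Implicit.
Unset Printing Implicit Defensive.

Import Order.TTheory GRing.Theory Num.Theory.
Import numFieldNormedType.Exports.

Local Open Scope classical_set_scope.
Local Open Scope complex_scope.
Local Open Scope ring_scope.

(* R[i] with its Borel sigma-algebra; R[i]^o carries the topology of the
   modulus. *)
Notation borelC R := (g_sigma_algebraType (@open (R[i])^o)).

Section ComplexFunctions.
Variable R : realType.

(* The modulus as an element of R; `|z| lives in R[i]. *)
Definition cabs (z : R[i]) : R := complex.Re `|z|.

Definition cexp (z : R[i]) : R[i] :=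
  (expR (complex.Re z))%:C * (cos (complex.Im z) +i* sin (complex.Im z)).

Definition right_half_plane : set R[i] := [set z | 0 < complex.Re z].

Section Integration.
Context d (T : measurableType d) (mu : {measure set T -> \bar R}).

Definition cintegrable (D : set T) (f : T -> R[i]) : Prop :=
  mu.-integrable D (fun x => (complex.Re (f x))%:E) /\
  mu.-integrable D (fun x => (complex.Im (f x))%:E).

Definition cintegral (D : set T) (f : T -> R[i]) : R[i] :=
  Rintegral mu D (fun x => complex.Re (f x)) +i*
  Rintegral mu D (fun x => complex.Im (f x)).

(* The extension of |f| by 0 outside D has the same L^p norm on T
   (0 < p <= +oo) as f has on D. *)
Definition Lp_norm (D : set T) (p : \bar R) (f : T -> R[i]) : \bar R :=
  Lnorm mu p ((fun x => (cabs (f x))%:E) \_ D).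

Definition Lp_space (D : set T) (p : \bar R) : set (T -> R[i]) :=
  [set f | measurable_fun D (f : T -> borelC R) /\
           (Lp_norm D p f < +oo)%E].

End Integration.

(* Measures on D are represented by measures on C: only the values on Borel
   subsets of D matter. When D is open, relatively open (resp. compact)
   subsets of D are the open (resp. compact) subsets of C contained in D. *)
Definition regular_on (mu : {measure set (borelC R) -> \bar R})
    (D : set R[i]) : Prop :=
  forall E : set (borelC R), measurable E -> E `<=` D ->
    mu E = ereal_inf [set mu U | U in
      [set U : set R[i] | [/\ @open (R[i])^o U, E `<=` U & U `<=` D]]] /\
    mu E = ereal_sup [set mu K | K in
      [set K : set R[i] | @compact (R[i])^o K /\ K `<=` E]].

End ComplexFunctions.

Section Orlicz.
Variable R : realType.
Local Notation leb := (@lebesgue_measure R).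

(* Functions on [0, +oo[ are given by functions on R whose values on negative
   reals are irrelevant. *)
Definition Young_function (Phi : R -> \bar R) : Prop :=
  exists phi : R -> \bar R,
    [/\ (forall s, 0 <= s -> (0 <= phi s)%E),
        (forall s t, 0 <= s -> s <= t -> (phi s <= phi t)%E),
        (forall t, 0 < t -> phi s @[s --> t^'-] --> phi t) &
     [/\ ~ (forall s, 0 <= s -> phi s = 0%E),
         ~ (forall s, 0 <= s -> phi s = +oo%E) &
         forall t, 0 <= t -> Phi t = (\int[leb]_(s in `[0%R, t]) phi s)%E]].

Definition N_function (Phi : R -> R) : Prop :=
  [/\ Young_function (EFin \o Phi),
      Phi x / x @[x --> 0^'+] --> (0 : R) &
      x / Phi x @[x --> +oo] --> (0 : R)].

Definition Orlicz_space (Phi : R -> \bar R) (J : interval R) :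
    set (R -> R[i]) :=
  [set f | measurable_fun [set` J] (f : R -> borelC R) /\
    exists2 k : R, 0 < k &
      leb.-integrable [set` J] (fun s => Phi (k^-1 * cabs (f s)))].

Definition Luxemburg_norm (Phi : R -> \bar R) (J : interval R)
    (f : R -> R[i]) : \bar R :=
  ereal_inf [set k%:E | k in [set k : R | 0 < k /\
    (\int[leb]_(s in [set` J]) Phi (k^-1 * cabs (f s))%R <= 1)%E]].

End Orlicz.

Section Laplace.
Variable R : realType.

Definition laplace_kernel (f : R -> R[i]) (z : R[i]) (t : R) : R[i] :=
  cexp (- (z * t%:C)) * f t.

Definition laplace (f : R -> R[i]) (z : R[i]) : R[i] :=
  cintegral (@lebesgue_measure R) `]0, +oo[ (laplace_kernel f z).

(* Boundedness of the Laplace transform from the function space X, normed by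
   nX, to L^q(C_+, mu). The integral is total in the library, so that the
   transform being well defined on C_+ is stated separately. *)
Definition laplace_bounded (X : set (R -> R[i])) (nX : (R -> R[i]) -> \bar R)
    (mu : {measure set (borelC R) -> \bar R}) (q : R) : Prop :=
  exists2 C : R, 0 <= C & forall f, X f ->
    [/\ forall z, right_half_plane z ->
          cintegrable (@lebesgue_measure R) `]0, +oo[ (laplace_kernel f z),
        Lp_space mu (@right_half_plane R) q%:E (laplace f) &
        (Lp_norm mu (@right_half_plane R) q%:E (laplace f) <= C%:E * nX f)%E].

End Laplace.

(* Main.v *)
Require Import Defs.
From HB Require Import structures.
From mathcomp Require Import all_boot all_order all_algebra.
From mathcomp Require Import all_classical all_reals all_analysis.
From mathcomp Require Import measurable_realfun complex ring lra.

(** Why the theorem is true.  Write [D] for the half line and [L] for the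
    transform, and let [energy f] be the integral of [|L f|^q] over the right
    half plane.  Boundedness of [L] on L^oo says that [energy f] is at most
    [C^q] whenever [|f| <= 1].

    The key point is [small_support]: [energy f] is uniformly small over the
    functions [f] with [|f| <= 1] and support of small measure.  Suppose that
    there are such functions [g] with energy above [e > 0] and support as
    small as desired.  If [f] is already given, Fatou's lemma
    ([energy_remove]) allows [f] to be replaced by 0 on the support of [g]
    without a noticeable loss of energy, provided that this support is small
    enough.  The supports of [f] and [g] are then disjoint, so that both
    [f + g] and [f - g] are still bounded by 1; and Clarkson's inequality
    [2 (|a|^q + |b|^q) <= |a + b|^q + |a - b|^q], valid for [q >= 2], shows
    that one of them has at least the energy of [f] plus that of [g]
    ([energy_splice]).  Iterating, the energy grows by [e] at each step and
    eventually exceeds [C^q], a contradiction.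

    Now let [r n] be such that [|f| <= 1] with support of measure at most
    [r n] implies that the norm of [L f] in L^q is at most [4^-(n+1)], and let
    [Phi] be an N-function growing so fast that [Phi (2^n) >= 1 / r n]
    ([fast_N_function]).  If the integral of [Phi |f|] is at most 1, the set
    where [|f| > 2^n] has measure at most [r n], so the part of [f] where
    [2^n < |f| <= 2^(n+1)] has a transform of norm at most
    [2^(n+1) 4^-(n+1) = 2^-(n+1)].  Summing over [n], and adding the bounded
    part of [f], [L f] has norm at most [C + 1] ([laplace_Orlicz_unit]);
    homogeneity gives the general bound. *)

Set Implicit Arguments.
Unset Strict Implicit.
Unset Printing Implicit Defensive.

Import Order.TTheory GRing.Theory Num.Theory.
Import numFieldNormedType.Exports.

Local Open Scope classical_set_scope.
Local Open Scope ring_scope.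

(** * The modulus and Borel functions with complex values *)

Section Modulus.
Variable R : realType.
Implicit Types (z w : R[i]) (x : R).

Lemma cabsE z :
  cabs z = Num.sqrt (complex.Re z ^+ 2 + complex.Im z ^+ 2).
Proof. by rewrite /cabs normc_def. Qed.

Lemma normc_cabs z : `|z| = ((cabs z)%:C)%C.
Proof. by rewrite /cabs normc_def. Qed.

Lemma cabs_ge0 z : 0 <= cabs z.
Proof. by rewrite cabsE sqrtr_ge0. Qed.

Lemma cabs0 : cabs (0 : R[i]) = 0.
Proof. by rewrite /cabs normr0. Qed.

Lemma cabsD z w : cabs (z + w) <= cabs z + cabs w.
Proof. by have := ler_normD z w; rewrite !normc_cabs -rmorphD lecR. Qed.

Lemma cabsM z w : cabs (z * w) = cabs z * cabs w.
Proof. by apply: complexI; rewrite rmorphM -!normc_cabs normrM. Qed.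

Lemma cabsN z : cabs (- z) = cabs z.
Proof. by rewrite /cabs normrN. Qed.

Lemma cabs_real x : cabs (x%:C)%C = `|x|.
Proof. by rewrite cabsE /= expr0n /= addr0 sqrtr_sqr. Qed.

Lemma Re_le_cabs z : `|complex.Re z| <= cabs z.
Proof. by rewrite cabsE -sqrtr_sqr ler_sqrt ?lerDl ?addr_ge0 ?sqr_ge0. Qed.

Lemma Im_le_cabs z : `|complex.Im z| <= cabs z.
Proof. by rewrite cabsE -sqrtr_sqr ler_sqrt ?lerDr ?addr_ge0 ?sqr_ge0. Qed.

Lemma cabs_le_ReIm z : cabs z <= `|complex.Re z| + `|complex.Im z|.
Proof.
have -> : z = ((complex.Re z)%:C + (complex.Im z)%:C * 'i)%C.
  by case: z => a b; simpc.
apply: le_trans (cabsD _ _) _; rewrite cabsM !cabs_real /=.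
by rewrite [X in _ * X]cabsE /= expr0n expr1n /= add0r sqrtr1 mulr1; simpc.
Qed.

Lemma cabs_dist z w : `|cabs z - cabs w| <= cabs (z - w).
Proof.
rewrite ler_norml; apply/andP; split.
  have := cabsD z (w - z); rewrite addrC subrK -(cabsN (w - z)) opprB; lra.
by have := cabsD w (z - w); rewrite addrC subrK; lra.
Qed.

Lemma cabs_cexp z : cabs (cexp z) = expR (complex.Re z).
Proof.
rewrite /cexp cabsM cabs_real ger0_norm ?expR_ge0//.
by rewrite [X in _ * X]cabsE /= cos2Dsin2 sqrtr1 mulr1.
Qed.

End Modulus.

Section Borel.
Variable R : realType.

(** The topology of the modulus, described with real radii. *)
Lemma open_cabs_ball (U : set R[i]) : @open (R[i])^o U <->
  forall z : R[i], U z ->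
    exists2 e : R, 0 < e & forall w : R[i], cabs (z - w) < e -> U w.
Proof.
rewrite openE; split => [oU z Uz|oU z Uz].
  have /nbhs_ballP [e e0 eU] := oU _ Uz.
  have [Ie Re0] : complex.Im e = 0 /\ 0 < complex.Re e.
    by move: e0; rewrite /= ltcE /= => /andP[/eqP].
  exists (complex.Re e) => // w zw; apply: eU.
  by rewrite /ball /= /ball_ normc_cabs ltcE /= zw Ie eqxx.
have [e e0 eU] := oU _ Uz; apply/nbhs_ballP; exists (e%:C)%C => /=.
  by rewrite ltcR.
by move=> w; rewrite /ball /= /ball_ normc_cabs ltcR => /eU.
Qed.

(** Lipschitz functions are continuous, hence Borel. *)
Lemma measurable_fun_lipR (g : R[i] -> R) :
  (forall z w, `|g z - g w| <= cabs (z - w)) ->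
  measurable_fun setT (g : borelC R -> R).
Proof.
move=> lip; apply: (measurability (@RGenOInfty.G R)) => [|/= _ [_] [r] -> <-].
  exact: RGenOInfty.measurableE.
rewrite setTI; apply: sub_sigma_algebra; apply/open_cabs_ball => z /=.
rewrite !in_itv /= !andbT => rz; exists (g z - r) => [|w zw] /=; first lra.
rewrite !in_itv /= andbT.
by have := lip z w; rewrite ler_norml => /andP[_]; lra.
Qed.

Lemma measurable_fun_lipC (g : R[i] -> R[i]) (k : R) : 0 < k ->
  (forall z w, cabs (g z - g w) <= k * cabs (z - w)) ->
  measurable_fun setT (g : borelC R -> borelC R).
Proof.
move=> k0 lip; apply: (measurability (@open (R[i])^o : set (set (borelC R)))) =>
  [//|/= _ [U oU <-]].
rewrite setTI; apply: sub_sigma_algebra; apply/open_cabs_ball => z /= Uz.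
have /open_cabs_ball /(_ _ Uz) [e e0 eU] := oU.
exists (e / k) => [|w zw]; first exact: divr_gt0.
by apply: eU; apply: le_lt_trans (lip _ _) _; rewrite mulrC -ltr_pdivlMr.
Qed.

Context d (T : measurableType d).

Lemma measurable_fun_lipR_comp (D : set T) (f : T -> R[i]) (g : R[i] -> R) :
  (forall z w, `|g z - g w| <= cabs (z - w)) ->
  measurable_fun D (f : T -> borelC R) -> measurable_fun D (g \o f).
Proof.
by move=> lip mf; apply: (measurableT_comp (measurable_fun_lipR lip)).
Qed.

Lemma measurable_fun_Re (D : set T) (f : T -> R[i]) :
  measurable_fun D (f : T -> borelC R) ->
  measurable_fun D (fun t => complex.Re (f t)).
Proof.
apply: measurable_fun_lipR_comp => z w.
by apply: le_trans (Re_le_cabs _); case: z w => [? ?] [? ?].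
Qed.

Lemma measurable_fun_Im (D : set T) (f : T -> R[i]) :
  measurable_fun D (f : T -> borelC R) ->
  measurable_fun D (fun t => complex.Im (f t)).
Proof.
apply: measurable_fun_lipR_comp => z w.
by apply: le_trans (Im_le_cabs _); case: z w => [? ?] [? ?].
Qed.

Lemma measurable_fun_cabs (D : set T) (f : T -> R[i]) :
  measurable_fun D (f : T -> borelC R) ->
  measurable_fun D (fun t => cabs (f t)).
Proof. by apply: measurable_fun_lipR_comp => z w; exact: cabs_dist. Qed.

Lemma measurable_fun_scaleC (D : set T) (f : T -> R[i]) (c : R[i]) :
  measurable_fun D (f : T -> borelC R) ->
  measurable_fun D ((fun t => c * f t) : T -> borelC R).
Proof.
suff mc : measurable_fun setT ((fun z => c * z) : borelC R -> borelC R).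
  by move=> mf; exact: (measurableT_comp mc mf).
apply: (@measurable_fun_lipC _ (cabs c + 1)) => [|z w].
  by rewrite ltr_wpDl ?cabs_ge0.
by rewrite -mulrBr cabsM ler_wpM2r ?cabs_ge0// lerDl.
Qed.

(** A pointwise limit of measurable functions is measurable: [f t] lies in an
    open set [U] iff, for some [k], the values [f_ n t] eventually keep a
    distance at least [1 / (k + 1)] from the complement of [U]. *)
Lemma measurable_fun_limC (D : set T) (f_ : nat -> T -> R[i]) (f : T -> R[i]) :
  measurable D ->
  (forall n, measurable_fun D (f_ n : T -> borelC R)) ->
  (forall t, D t -> cabs (f t - f_ n t) @[n --> \oo] --> (0 : R)) ->
  measurable_fun D (f : T -> borelC R).
Proof.
move=> mD mf_ cf.
apply: (measurability (@open (R[i])^o : set (set (borelC R)))) =>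
  [//|/= _ [U /open_cabs_ball oU <-]].
pose G k : set R[i] :=
  [set z : R[i] | exists2 w : R[i], ~ U w & cabs (z - w) < k.+1%:R^-1].
have mG k : measurable (G k : set (borelC R)).
  apply: sub_sigma_algebra; apply/open_cabs_ball => z [w Uw zw].
  exists (k.+1%:R^-1 - cabs (z - w)) => [|v zv]; first by rewrite subr_gt0.
  exists w => //; have := cabsD (v - z) (z - w).
  rewrite -(cabsN (v - z)) opprB addrA subrK => /le_lt_trans; apply.
  by rewrite -ltrBrDr.
suff -> : D `&` f @^-1` U =
    \bigcup_k \bigcup_m \bigcap_(n in [set n | (m <= n)%N])
      (D `&` f_ n @^-1` (~` G k)).
  apply: bigcupT_measurable => k; apply: bigcupT_measurable => m.
  by apply: bigcap_measurableType => n _; apply: mf_ => //; exact: measurableC.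
have near_f t (e : R) : D t -> 0 < e ->
    exists N, forall n, (N <= n)%N -> cabs (f t - f_ n t) < e.
  move=> Dt e0; have /cvgrPdist_lt /(_ _ e0) [N _ hN] := cf _ Dt.
  by exists N => n /hN; rewrite sub0r normrN ger0_norm ?cabs_ge0.
apply/seteqP; split => t.
  move=> [Dt /= /oU [e e0 eU]].
  have e2 : 0 < e / 2 by rewrite divr_gt0.
  have [k ke] : exists k : nat, k.+1%:R^-1 < e / 2.
    have [k _ /(_ _ (leqnn k)) hk] := near_infty_natSinv_lt (PosNum e2).
    by exists k.
  have [N hN] := near_f t _ Dt e2.
  exists k => //; exists N => // n /= /hN fn; split => //= -[w Uw fw].
  apply: Uw; apply: eU; have := cabsD (f t - f_ n t) (f_ n t - w).
  rewrite addrA subrK => /le_lt_trans; apply.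
  by rewrite (splitr e); apply: ltrD => //; exact: lt_trans ke.
move=> [k _ [m _ hm]]; have [Dt _] := hm m (leqnn m); split => //=.
have k0 : 0 < k.+1%:R^-1 :> R by rewrite invr_gt0.
have [N hN] := near_f t _ Dt k0.
have [_ /= nG] := hm (maxn m N) (leq_maxl _ _).
apply: contrapT => nU; apply: nG; exists (f t) => //.
by rewrite -cabsN opprB; apply: hN; exact: leq_maxr.
Qed.

End Borel.

(** * Clarkson's inequality *)

Section PowerInequalities.
Variable R : realType.
Implicit Types (x y r : R).

Lemma powR_superadditive r x y : 1 <= r -> 0 <= x -> 0 <= y ->
  x `^ r + y `^ r <= (x + y) `^ r.
Proof.
move=> r1 x0 y0; have r0 : 0 < r by exact: lt_le_trans r1.
have powE z : 0 <= z -> z `^ r = z * z `^ (r - 1).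
  rewrite le_eqVlt => /predU1P[<-|z0]; first by rewrite mul0r powR0 ?gt_eqF.
  by rewrite -{2}(powRr1 (ltW z0)) -powRD ?gt_eqF ?implybT// addrC subrK.
rewrite !powE ?addr_ge0// mulrDl lerD// ler_wpM2l//;
  by rewrite ge0_ler_powR ?nnegrE ?subr_ge0 ?addr_ge0// ?lerDl ?lerDr.
Qed.

Lemma powR_midpoint r x y : 1 <= r -> 0 <= x -> 0 <= y ->
  2 * ((x + y) / 2) `^ r <= x `^ r + y `^ r.
Proof.
move=> r1 x0 y0.
have h0 : (0 : R) <= 2^-1 by rewrite invr_ge0.
have h1 : (2^-1 : R) <= 1 by rewrite invf_le1 ?ler1n.
have /(_ x y) := convex_powR r1 (Itv01 h0 h1).
rewrite !inE /= !in_itv /= !andbT => /(_ x0 y0).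
rewrite convRE [X in X `^ _ <= _]convRE /= /unstable.onem.
have -> : 1 - 2^-1 = 2^-1 :> R by lra.
have -> : 2^-1 * x + 2^-1 * y = (x + y) / 2 :> R by lra.
by move=> H; lra.
Qed.

(** One of Clarkson's inequalities: the parallelogram law, raised to the power
    [q / 2 >= 1], which is both convex and superadditive. *)
Lemma clarkson (q : R) (z w : R[i]) : 2 <= q ->
  2 * (cabs z `^ q + cabs w `^ q) <= cabs (z + w) `^ q + cabs (z - w) `^ q.
Proof.
move=> q2; have r1 : 1 <= q / 2 by rewrite ler_pdivlMr ?mul1r.
have sqr (v : R[i]) : cabs v `^ q = (cabs v ^+ 2) `^ (q / 2).
  rewrite -powR_mulrn ?cabs_ge0// -powRrM; congr (_ `^ _); lra.
have par : cabs (z + w) ^+ 2 + cabs (z - w) ^+ 2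
    = (cabs z ^+ 2 + cabs w ^+ 2) * 2.
  rewrite !cabsE !sqr_sqrtr ?addr_ge0 ?sqr_ge0//.
  by case: z w => [a b] [c e] /=; ring.
rewrite !sqr.
have s0 (v : R[i]) : 0 <= cabs v ^+ 2 by rewrite sqr_ge0.
apply: le_trans (powR_midpoint r1 (s0 _) (s0 _)).
rewrite par mulfK ?pnatr_eq0// ler_wpM2l//.
exact: powR_superadditive.
Qed.

End PowerInequalities.

(** * Norms in L^p of functions with complex values *)

Section LimInf.
Variable R : realType.
Implicit Types (u : nat -> \bar R).

Lemma limn_einf_le u (c : \bar R) :
  (forall n, (u n <= c)%E) -> (limn_einf u <= c)%E.
Proof.
move=> uc; rewrite limn_einf_lim; apply: lime_le.
  exact: is_cvg_einfs.
apply: nearW => n; apply: le_trans (uc n).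
by apply: ereal_inf_lbound; exists n => /=.
Qed.

Lemma cvg_powRl (p : R) (v : nat -> R) (l : R) : 0 < p ->
  (forall n, 0 <= v n) -> v n @[n --> \oo] --> l ->
  v n `^ p @[n --> \oo] --> l `^ p.
Proof.
move=> p0 v0 vl.
have : 0 <= l.
  rewrite -(cvg_lim _ vl)//.
  by apply: limr_ge; [exact: cvgP vl|exact: nearW].
rewrite le_eqVlt => /predU1P[l0|l0].
  move: vl; rewrite -l0 powR0 ?gt_eqF// => vl.
  apply/cvgrPdist_lt => e e0.
  have e1 : 0 < e `^ p^-1 by rewrite powR_gt0.
  near=> n; rewrite sub0r normrN ger0_norm ?powR_ge0//.
  have : v n < e `^ p^-1.
    have : `|0 - v n| < e `^ p^-1.
      by near: n; move/cvgrPdist_lt : vl => /(_ _ e1).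
    by rewrite sub0r normrN ger0_norm.
  move=> /(gt0_ltr_powR p0); rewrite !nnegrE => /(_ (v0 n) (powR_ge0 _ _)).
  by rewrite -powRrM mulVf ?gt_eqF// powRr1// ltW.
have vp : \forall n \near \oo, 0 < v n.
  move/cvgrPdist_lt : vl => /(_ _ l0); apply: filterS => n.
  by rewrite ltr_norml => /andP[_]; lra.
rewrite {2}/powR gt_eqF//.
apply: (@cvg_trans _ (expR (p * ln (v n)) @[n --> \oo])).
  apply: near_eq_cvg; near=> n; rewrite /powR gt_eqF//.
  by near: n.
apply: continuous_cvg; first exact: continuous_expR.
apply: cvgMr; apply: continuous_cvg => //.
exact: continuous_ln.
Unshelve. all: by end_near. Qed.

End LimInf.

Section LpNorm.
Context d (T : measurableType d) (R : realType).
Variable mu : {measure set T -> \bar R}.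
Variables (D : set T) (mD : measurable D).
Implicit Types (f g : T -> R[i]) (p c : R).

Lemma Lp_norm_powR p f : 0 < p ->
  (Lp_norm mu D p%:E f `^ p = \int[mu]_(x in D) (cabs (f x) `^ p)%:E)%E.
Proof.
move=> p0; rewrite /Lp_norm poweR_Lnorm ?gt_eqF// [RHS]integral_mkcond.
apply: eq_integral => x _; rewrite !patchE; case: ifPn => _.
  by rewrite /= ger0_norm ?cabs_ge0.
by rewrite abse0 poweR0r ?gt_eqF.
Qed.

Lemma Lp_norm_le p c f : 0 < p -> 0 <= c ->
  (Lp_norm mu D p%:E f <= c%:E)%E =
  (\int[mu]_(x in D) (cabs (f x) `^ p)%:E <= (c `^ p)%:E)%E.
Proof.
move=> p0 c0; rewrite -Lp_norm_powR// -poweR_EFin.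
have pK (x : \bar R) : (0 <= x)%E -> ((x `^ p) `^ p^-1)%E = x.
  by move=> x0; rewrite -poweRrM mulfV ?gt_eqF// poweRe1.
have mon r : 0 <= r -> {in [pred x : \bar R | (0 <= x)%E] &,
    {homo poweR^~ r : x y / (x <= y)%E}}.
  move=> r0 x y; rewrite !inE /= => x0 y0.
  by apply: gt0_ler_poweR; rewrite // in_itv /= ?x0 ?y0 leey.
have N0 : (0 <= Lp_norm mu D p%:E f)%E by exact: Lnorm_ge0.
apply/idP/idP => [|/(mon p^-1)].
  by apply: mon; rewrite ?inE ?lee_fin// ltW.
by rewrite !pK ?lee_fin//; apply; rewrite ?inE ?poweR_ge0// invr_ge0 ltW.
Qed.


Lemma measurable_fun_cabs_powR p f :
  measurable_fun D (f : T -> borelC R) ->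
  measurable_fun D (fun x => (cabs (f x) `^ p)%:E).
Proof.
move=> mf; apply/measurable_EFinP.
exact: (measurableT_comp (measurable_powR p) (measurable_fun_cabs mf)).
Qed.

(** Balls of L^p are closed under pointwise limits. *)
Lemma fatou_Lp p (c : \bar R) (f_ : nat -> T -> R[i]) f : 0 < p ->
  (forall n, measurable_fun D (f_ n : T -> borelC R)) ->
  (forall x, D x -> cabs (f x - f_ n x) @[n --> \oo] --> (0 : R)) ->
  (forall n, \int[mu]_(x in D) (cabs (f_ n x) `^ p)%:E <= c)%E ->
  (\int[mu]_(x in D) (cabs (f x) `^ p)%:E <= c)%E.
Proof.
move=> p0 mf_ ff_ fc.
have mf := measurable_fun_limC mD mf_ ff_.
pose h n x := (cabs (f_ n x) `^ p)%:E.
have -> : (\int[mu]_(x in D) (cabs (f x) `^ p)%:E =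
    \int[mu]_(x in D) limn_einf (h ^~ x))%E.
  apply: eq_integral => x /set_mem Dx.
  suff /cvg_limn_einf_sup[-> //] : h n x @[n --> \oo] --> (cabs (f x) `^ p)%:E.
  apply: cvg_EFin; first exact: nearW.
  apply: cvg_powRl => //; first by move=> n; exact: cabs_ge0.
  have := ff_ _ Dx => /cvgrPdist_lt H; apply/cvgrPdist_lt => e e0.
  near=> n; apply: le_lt_trans (cabs_dist _ _) _.
  have : `|0 - cabs (f x - f_ n x)| < e by near: n; exact: H.
  by rewrite sub0r normrN ger0_norm ?cabs_ge0.
apply: le_trans (fatou _ _ _ _) _ => //.
- by move=> n; exact: measurable_fun_cabs_powR.
- by move=> n x _; rewrite lee_fin powR_ge0.
- exact: limn_einf_le.
Unshelve. all: by end_near. Qed.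

(** Minkowski's inequality, for any [h] dominated by [|f| + |g|]. *)
Lemma Lp_norm_triangle p h f g : 1 <= p ->
  measurable_fun D (h : T -> borelC R) ->
  measurable_fun D (f : T -> borelC R) ->
  measurable_fun D (g : T -> borelC R) ->
  (forall x, D x -> cabs (h x) <= cabs (f x) + cabs (g x)) ->
  (Lp_norm mu D p%:E h <= Lp_norm mu D p%:E f + Lp_norm mu D p%:E g)%E.
Proof.
move=> p1 mh mf mg hfg; have p0 : 0 < p by exact: lt_le_trans p1.
have mrestr (u : T -> R[i]) : measurable_fun D (u : T -> borelC R) ->
    measurable_fun setT ((fun x => cabs (u x)) \_ D).
  by move=> mu'; apply/(measurable_restrictT _ mD); exact: measurable_fun_cabs.
have NE u : Lp_norm mu D p%:E u =
    Lnorm mu p%:E (EFin \o ((fun x => cabs (u x)) \_ D)).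
  by rewrite /Lp_norm restrict_EFin.
rewrite !NE; apply: le_trans (minkowski_EFin mu (mrestr _ mf) (mrestr _ mg) p1).
rewrite unlock; apply: gt0_ler_poweR.
- by rewrite invr_ge0 ltW.
- by rewrite in_itv /= leey andbT integral_ge0// => x _; exact: poweR_ge0.
- by rewrite in_itv /= leey andbT integral_ge0// => x _; exact: poweR_ge0.
have mp (v : T -> R) : measurable_fun setT v ->
    measurable_fun setT (fun x => (`|(EFin \o v) x| `^ p)%E).
  move=> mv; apply/measurable_EFinP.
  apply: (measurableT_comp (measurable_powR p)).
  exact: measurableT_comp.
apply: ge0_le_integral => //.
- by move=> x _; exact: poweR_ge0.
- by apply: mp; exact: mrestr.
- by apply: mp; apply: measurable_funD; exact: mrestr.
move=> x _ /=; rewrite !lee_fin ge0_ler_powR ?nnegrE ?(ltW p0)//.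
rewrite !patchE; case: ifPn => [/set_mem Dx|_].
  by rewrite !ger0_norm ?addr_ge0 ?cabs_ge0 ?hfg.
by rewrite [point](_ : _ = 0)// addr0.
Qed.

Lemma clarkson_Lp p f g hp hm : 2 <= p ->
  measurable_fun D (f : T -> borelC R) ->
  measurable_fun D (g : T -> borelC R) ->
  measurable_fun D (hp : T -> borelC R) ->
  measurable_fun D (hm : T -> borelC R) ->
  (forall x, D x -> hp x = f x + g x) -> (forall x, D x -> hm x = f x - g x) ->
  (2%:E * (\int[mu]_(x in D) (cabs (f x) `^ p)%:E +
           \int[mu]_(x in D) (cabs (g x) `^ p)%:E) <=
   \int[mu]_(x in D) (cabs (hp x) `^ p)%:E +
   \int[mu]_(x in D) (cabs (hm x) `^ p)%:E)%E.
Proof.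
move=> p2 mf mg mp mm Ep Em.
have pos (u : T -> R[i]) x : (0 <= (cabs (u x) `^ p)%:E)%E.
  by rewrite lee_fin powR_ge0.
have mpow := measurable_fun_cabs_powR p.
rewrite -!(ge0_integralD mu mD)//; try exact: mpow.
rewrite -(ge0_integralZl mu mD)//; last 2 first.
- by apply: emeasurable_funD; exact: mpow.
- by move=> x _; rewrite adde_ge0.
apply: ge0_le_integral => //.
- by move=> x _; rewrite mule_ge0 ?adde_ge0.
- by apply: measurable_funeM; apply: emeasurable_funD; exact: mpow.
- by apply: emeasurable_funD; exact: mpow.
- move=> x Dx; rewrite -!EFinD -EFinM lee_fin Ep// Em//.
  exact: clarkson.
Qed.

Lemma Lp_norm_scale_le p (k : R) c f g : 0 < p -> 0 <= k -> 0 <= c ->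
  measurable_fun D (f : T -> borelC R) ->
  measurable_fun D (g : T -> borelC R) ->
  (forall x, D x -> cabs (g x) <= k * cabs (f x)) ->
  (Lp_norm mu D p%:E f <= c%:E)%E -> (Lp_norm mu D p%:E g <= (k * c)%:E)%E.
Proof.
move=> p0 k0 c0 mf mg gf; rewrite !Lp_norm_le ?mulr_ge0// => fc.
have pos (u : T -> R[i]) x : (0 <= (cabs (u x) `^ p)%:E)%E.
  by rewrite lee_fin powR_ge0.
apply: (@le_trans _ _
    (\int[mu]_(x in D) ((k `^ p)%:E * (cabs (f x) `^ p)%:E))%E).
  apply: ge0_le_integral => //.
  - exact: measurable_fun_cabs_powR.
  - by apply: measurable_funeM; exact: measurable_fun_cabs_powR.
  - move=> x Dx; rewrite -EFinM lee_fin -powRM ?cabs_ge0//.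
    by rewrite ge0_ler_powR ?nnegrE ?mulr_ge0 ?cabs_ge0 ?gf// ltW.
rewrite (ge0_integralZl mu mD)//; last 2 first.
- exact: measurable_fun_cabs_powR.
- by rewrite lee_fin powR_ge0.
by rewrite powRM// EFinM; apply: lee_wpmul2l => //; rewrite lee_fin powR_ge0.
Qed.

End LpNorm.

(** * Integrals of functions with complex values *)

Section ComplexIntegral.
Context d (T : measurableType d) (R : realType).
Variable mu : {measure set T -> \bar R}.
Variables (D : set T) (mD : measurable D).
Implicit Types (f g : T -> R[i]).

Lemma cintegralD f g : cintegrable mu D f -> cintegrable mu D g ->
  cintegral mu D (fun x => f x + g x) = cintegral mu D f + cintegral mu D g.
Proof.
move=> [rf jf] [rg jg]; rewrite /cintegral.
rewrite [RHS](_ : _ = ((Rintegral mu D (fun x => complex.Re (f x)) +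
  Rintegral mu D (fun x => complex.Re (g x))) +i*
  (Rintegral mu D (fun x => complex.Im (f x)) +
  Rintegral mu D (fun x => complex.Im (g x))))%C)//.
rewrite -RintegralD// -RintegralD//.
by congr (_ +i* _)%C; apply: eq_Rintegral => x _;
  case: (f x) (g x) => [? ?] [? ?].
Qed.

Lemma cintegrableZ (k : R) f : cintegrable mu D f ->
  cintegrable mu D (fun x => (k%:C)%C * f x).
Proof.
move=> [rf jf]; split.
  apply: (eq_integrable mD _ _ _ (integrableZl mD k rf)) => x _.
  by rewrite -EFinM; case: (f x) => [? ?] /=; rewrite mul0r subr0.
apply: (eq_integrable mD _ _ _ (integrableZl mD k jf)) => x _.
by rewrite -EFinM; case: (f x) => [? ?] /=; rewrite mul0r addr0.
Qed.

Lemma cintegralZ (k : R) f : cintegrable mu D f ->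
  cintegral mu D (fun x => (k%:C)%C * f x) = (k%:C)%C * cintegral mu D f.
Proof.
move=> [rf jf]; rewrite /cintegral.
rewrite [RHS](_ : _ = ((k * Rintegral mu D (fun x => complex.Re (f x))) +i*
  (k * Rintegral mu D (fun x => complex.Im (f x))))%C); last by simpc.
rewrite -RintegralZl// -RintegralZl//.
congr (_ +i* _)%C; apply: eq_Rintegral => x _;
  by case: (f x) => [? ?] /=; rewrite mul0r ?subr0 ?addr0.
Qed.

Lemma eq_cintegral f g : (forall x, D x -> f x = g x) ->
  cintegral mu D f = cintegral mu D g.
Proof.
by move=> fg; congr (_ +i* _)%C; apply: eq_Rintegral => x /set_mem /fg ->.
Qed.

Lemma eq_cintegrable f g : (forall x, D x -> f x = g x) ->
  cintegrable mu D f -> cintegrable mu D g.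
Proof.
by move=> fg [rf jf]; split; [move: rf|move: jf]; apply: (eq_integrable mD) => x
  /set_mem /fg /= ->.
Qed.

Lemma cintegrable_le (f : T -> R[i]) (h : T -> R) :
  measurable_fun D (fun x => complex.Re (f x)) ->
  measurable_fun D (fun x => complex.Im (f x)) ->
  mu.-integrable D (EFin \o h) -> (forall x, D x -> cabs (f x) <= h x) ->
  cintegrable mu D f.
Proof.
move=> mr mi ih fh; split.
  apply: (le_integrable mD _ _ ih); first exact/measurable_EFinP.
  move=> x Dx /=; rewrite lee_fin (le_trans (Re_le_cabs _))//.
  by rewrite (le_trans (fh _ Dx))// ler_norm.
apply: (le_integrable mD _ _ ih); first exact/measurable_EFinP.
move=> x Dx /=; rewrite lee_fin (le_trans (Im_le_cabs _))//.
by rewrite (le_trans (fh _ Dx))// ler_norm.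
Qed.

Lemma cabs_cintegral_le (f : T -> R[i]) (h : T -> R) :
  cintegrable mu D f ->
  mu.-integrable D (EFin \o h) -> (forall x, D x -> cabs (f x) <= h x) ->
  cabs (cintegral mu D f) <= 2 * Rintegral mu D h.
Proof.
move=> [rf jf] ih fh; apply: le_trans (cabs_le_ReIm _) _.
rewrite mulr_natl mulr2n; apply: lerD => /=.
  apply: le_trans (le_normr_Rintegral mD rf) _.
  apply: le_Rintegral => //; first exact: (integrable_abse rf).
  by move=> x Dx; apply: le_trans (Re_le_cabs _) (fh _ Dx).
apply: le_trans (le_normr_Rintegral mD jf) _.
apply: le_Rintegral => //; first exact: (integrable_abse jf).
by move=> x Dx; apply: le_trans (Im_le_cabs _) (fh _ Dx).
Qed.

Lemma Rintegral_dominated_cvg (u_ : nat -> T -> R) (u h : T -> R) :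
  (forall n, measurable_fun D (u_ n)) -> measurable_fun D u ->
  (forall x, D x -> u_ n x @[n --> \oo] --> u x) ->
  mu.-integrable D (EFin \o h) -> (forall n x, D x -> `|u_ n x| <= h x) ->
  Rintegral mu D (u_ n) @[n --> \oo] --> Rintegral mu D u.
Proof.
move=> mu_ mu' cu ih uh.
have [iu _ cv] : [/\ mu.-integrable D (EFin \o u),
    [sequence \int[mu]_(x in D) `|(EFin \o u_ n) x - (EFin \o u) x|]_n
      @ \oo --> 0%E &
    [sequence \int[mu]_(x in D) ((EFin \o u_ n) x)]_n @ \oo -->
      \int[mu]_(x in D) ((EFin \o u) x)]%E.
  apply: (@dominated_convergence _ _ _ _ _ mD _ _ (EFin \o h)) => //.
  - by move=> n; exact/measurable_EFinP.
  - exact/measurable_EFinP.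
  - apply: aeW => x Dx; apply: cvg_EFin; first exact: nearW.
    exact: cu.
  - by apply: aeW => x n Dx /=; rewrite lee_fin uh.
by apply: fine_cvg; rewrite fineK ?integrable_fin_num.
Qed.

(** Dominated convergence, for sequences that are eventually stationary at
    each point. *)
Lemma cintegral_dominated_cvg (f_ : nat -> T -> R[i]) f (h : T -> R) :
  (forall n, measurable_fun D (fun x => complex.Re (f_ n x)) /\
             measurable_fun D (fun x => complex.Im (f_ n x))) ->
  measurable_fun D (fun x => complex.Re (f x)) ->
  measurable_fun D (fun x => complex.Im (f x)) ->
  (forall x, D x -> \forall n \near \oo, f_ n x = f x) ->
  mu.-integrable D (EFin \o h) -> (forall n x, D x -> cabs (f_ n x) <= h x) ->
  cabs (cintegral mu D f - cintegral mu D (f_ n)) @[n --> \oo] --> (0 : R).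
Proof.
move=> mf_ mrf mif cf ih fh.
have cr : Rintegral mu D (fun x => complex.Re (f_ n x)) @[n --> \oo] -->
    Rintegral mu D (fun x => complex.Re (f x)).
  apply: (@Rintegral_dominated_cvg _ _ h) => //.
  - by move=> n; case: (mf_ n).
  - move=> x Dx; apply: cvg_near_cst.
    by apply: filterS (cf _ Dx) => n ->.
  - by move=> n x Dx; apply: le_trans (Re_le_cabs _) (fh _ _ Dx).
have ci : Rintegral mu D (fun x => complex.Im (f_ n x)) @[n --> \oo] -->
    Rintegral mu D (fun x => complex.Im (f x)).
  apply: (@Rintegral_dominated_cvg _ _ h) => //.
  - by move=> n; case: (mf_ n).
  - move=> x Dx; apply: cvg_near_cst.
    by apply: filterS (cf _ Dx) => n ->.
  - by move=> n x Dx; apply: le_trans (Im_le_cabs _) (fh _ _ Dx).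
apply/cvgrPdist_lt => e e0; near=> n.
rewrite sub0r normrN ger0_norm ?cabs_ge0// (splitr e).
apply: le_lt_trans (cabs_le_ReIm _) _; rewrite /=; apply: ltrD; near: n.
  by move/cvgrPdist_lt : cr; apply; rewrite divr_gt0.
by move/cvgrPdist_lt : ci; apply; rewrite divr_gt0.
Unshelve. all: by end_near. Qed.

End ComplexIntegral.

(** * The kernel of the Laplace transform *)

Section LaplaceKernel.
Variable R : realType.
Local Notation leb := (@lebesgue_measure R).
Local Notation D := (`]0%R, +oo[%classic : set R).
Implicit Types (f g : R -> R[i]) (z : R[i]).

(** The function equal to [g] on [A] and to [f] elsewhere. *)
Definition splice (A : set R) g f : R -> R[i] :=
  fun t => if t \in A then g t else f t.

Lemma measurable_half_line : measurable (D : set (measurableTypeR R)).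
Proof. exact: measurable_itv. Qed.

Lemma measurable_right_half_plane :
  measurable (@right_half_plane R : set (borelC R)).
Proof.
apply: sub_sigma_algebra; apply/open_cabs_ball => z /= z0.
exists (complex.Re z) => // w zw; rewrite /right_half_plane /=.
have := le_lt_trans (Re_le_cabs _) zw; rewrite ltr_norml => /andP[_].
by case: z w {z0 zw} => [a b] [c e] /=; lra.
Qed.

Lemma measurable_splice (A : set R) g f : measurable A ->
  measurable_fun D (g : R -> borelC R) ->
  measurable_fun D (f : R -> borelC R) ->
  measurable_fun D (splice A g f : R -> borelC R).
Proof.
move=> mA mg mf _ Y mY.
rewrite (_ : _ `&` _ = (A `&` (D `&` g @^-1` Y)) `|`
    (~` A `&` (D `&` f @^-1` Y))); last first.
  apply/seteqP; split => t /=; rewrite /splice.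
    by move=> [Dt]; case: ifPn => [/set_mem|/negP nA]; [left|right;
      split => // At; apply: nA; exact: mem_set].
  by move=> [|] [At [Dt Yt]]; split => //; [rewrite mem_set|rewrite memNset].
apply: measurableU; apply: measurableI => //.
- exact: mg.
- exact: measurableC.
- exact: mf.
Qed.

Lemma cabs_laplace_kernel f z t :
  cabs (laplace_kernel f z t) = expR (- (complex.Re z * t)) * cabs (f t).
Proof.
rewrite /laplace_kernel cabsM cabs_cexp; congr (expR _ * _).
by case: z => a b /=; rewrite mulr0 subr0.
Qed.

Lemma cabs_laplace_kernel_le f z t : 0 < complex.Re z -> 0 < t ->
  cabs (laplace_kernel f z t) <= cabs (f t).
Proof.
move=> z0 t0; rewrite cabs_laplace_kernel ler_piMl ?cabs_ge0//.
by rewrite -expR0 ler_expR oppr_le0 mulr_ge0 ?ltW.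
Qed.

Lemma laplace_kernelE f z t (a := complex.Re z) (b := complex.Im z) :
  laplace_kernel f z t = ((expR (- (a * t)))%:C *
   ((cos (- (b * t)) * complex.Re (f t)
     - sin (- (b * t)) * complex.Im (f t)) +i*
    (cos (- (b * t)) * complex.Im (f t)
     + sin (- (b * t)) * complex.Re (f t))))%C.
Proof.
rewrite {}/a {}/b /laplace_kernel /cexp -mulrA; case: z (f t) => [x y] [u v] /=.
by rewrite !(mulr0, subr0, add0r).
Qed.

Lemma measurable_laplace_kernel f z : measurable_fun D (f : R -> borelC R) ->
  measurable_fun D (fun t => complex.Re (laplace_kernel f z t)) /\
  measurable_fun D (fun t => complex.Im (laplace_kernel f z t)).
Proof.
move=> mf; have mr := measurable_fun_Re mf; have mi := measurable_fun_Im mf.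
pose a := complex.Re z; pose b := complex.Im z.
have mlin c : measurable_fun D (fun t : R => - (c * t)).
  rewrite (_ : (fun t => _) = *%R (- c)); last first.
    by apply/funext => t; rewrite mulNr.
  exact: mulrl_measurable.
have me : measurable_fun D (fun t => expR (- (a * t))).
  exact: (measurableT_comp (@measurable_expR R) (mlin a)).
have mcos : measurable_fun D (fun t => cos (- (b * t))).
  apply: measurableT_comp (mlin b); apply: continuous_measurable_fun.
  exact: continuous_cos.
have msin : measurable_fun D (fun t => sin (- (b * t))).
  apply: measurableT_comp (mlin b); apply: continuous_measurable_fun.
  exact: continuous_sin.
split.
  apply: (eq_measurable_fun (fun t => expR (- (a * t)) *
    (cos (- (b * t)) * complex.Re (f t) - sin (- (b * t)) * complex.Im (f t)))).
    by move=> t _; rewrite laplace_kernelE /= mul0r subr0.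
  apply: measurable_funM => //; apply: measurable_funB; exact: measurable_funM.
apply: (eq_measurable_fun (fun t => expR (- (a * t)) *
    (cos (- (b * t)) * complex.Im (f t) + sin (- (b * t)) * complex.Re (f t)))).
  by move=> t _; rewrite laplace_kernelE /= mul0r addr0.
apply: measurable_funM => //; apply: measurable_funD; exact: measurable_funM.
Qed.

(** The integral defining the transform of [f] at [z] converges absolutely. *)
Definition laplace_convergent f z := cintegrable leb D (laplace_kernel f z).

Lemma eq_laplace f g z : (forall t, D t -> f t = g t) ->
  laplace f z = laplace g z.
Proof.
by move=> fg; apply: eq_cintegral => t Dt; rewrite /laplace_kernel fg.
Qed.

Lemma laplaceD f g z : laplace_convergent f z -> laplace_convergent g z ->
  laplace (fun t => f t + g t) z = laplace f z + laplace g z.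
Proof.
move=> cf cg; rewrite /laplace -cintegralD//.
by apply: eq_cintegral => t _; rewrite /laplace_kernel mulrDr.
Qed.

Lemma laplaceZ (k : R) f z : laplace_convergent f z ->
  laplace (fun t => (k%:C)%C * f t) z = (k%:C)%C * laplace f z.
Proof.
move=> cf; rewrite /laplace -cintegralZ//.
by apply: eq_cintegral => t _; rewrite /laplace_kernel mulrCA.
Qed.

Lemma laplace_convergentZ (k : R) f z : laplace_convergent f z ->
  laplace_convergent (fun t => (k%:C)%C * f t) z.
Proof.
move=> cf; 
refine (eq_cintegrable measurable_half_line _
  (cintegrableZ measurable_half_line k cf)).
by move=> t _; rewrite /laplace_kernel mulrCA.
Qed.

(** The transform at a given point of a function bounded by 1 is controlled
    by the measure of the support. *)
Lemma cabs_laplace_small_support (A : set R) f z (e : R) : 0 < complex.Re z ->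
  measurable A -> (leb A <= e%:E)%E -> laplace_convergent f z ->
  (forall t, D t -> cabs (f t) <= 1) -> (forall t, D t -> ~ A t -> f t = 0) ->
  cabs (laplace f z) <= 2 * e.
Proof.
move=> z0 mA Ae cf f1 fA.
have mD := measurable_half_line.
have mA' : measurable (A : set (measurableTypeR R)) by [].
have IA : (\int[leb]_(t in D) (\1_A t)%:E <= e%:E)%E.
  rewrite integral_indic//; apply: le_trans Ae.
  by rewrite le_measure ?inE//; exact: measurableI.
have iA : leb.-integrable D (EFin \o (\1_A : R -> R)).
  apply/integrableP; split; first exact/measurable_EFinP/measurable_indic.
  apply: le_lt_trans (ltry e); apply: le_trans IA.
  by under eq_integral do rewrite /= ger0_norm//.
apply: le_trans (cabs_cintegral_le mD cf iA _) _.
  move=> t Dt; have t0 : 0 < t by move: Dt; rewrite /= in_itv /= andbT.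
  apply: le_trans (cabs_laplace_kernel_le _ z0 t0) _.
  rewrite indicE; have [At|At] := pselect (A t); first by rewrite mem_set// f1.
  by rewrite fA// cabs0.
rewrite ler_pM2l// -lee_fin fineK//.
exact: integrable_fin_num.
Qed.

End LaplaceKernel.

(** * N-functions with fast growth *)

Section FastNFunction.
Variable R : realType.
Local Notation leb := (@lebesgue_measure R).
Variable b : nat -> R.
Implicit Types (s t x y : R).
Hypothesis b1 : forall n, 1 <= b n.
Hypothesis b_nd : {homo b : m n / (m <= n)%N >-> m <= n}.

(** The density [s * b (ceil s)], extended by 0 to the negative reals. *)
Definition density (s : R) : R :=
  Num.max s 0 * b `|Num.ceil (Num.max s 0)%R|%N.

(** The Young function with density [density]; it vanishes on negative
    reals. *)
Definition density_primitive (x : R) : R :=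
  Rintegral leb `[0, x]%classic density.

Lemma density_ge0 s : 0 <= density s.
Proof.
by rewrite mulr_ge0 ?le_max ?lexx ?orbT// (le_trans ler01).
Qed.

Lemma density_nd : {homo density : s t / s <= t}.
Proof.
move=> s t st; have m0 u : 0 <= Num.max u 0 :> R by rewrite le_max lexx orbT.
have mst : Num.max s 0 <= Num.max t 0 by rewrite ge_max !le_max st lexx orbT.
rewrite ler_pM// ?m0 ?(le_trans ler01)//; apply: b_nd.
rewrite -lez_nat !gez0_abs ?ceil_ge0 ?(lt_le_trans _ (m0 _)) ?ltrN10//.
by rewrite le_ceil.
Qed.

Lemma density_ge s : s <= density s.
Proof.
have [s0|s0] := leP s 0; first exact: le_trans s0 (density_ge0 s).
by rewrite /density max_l ?(ltW s0)// ler_peMr// ltW.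
Qed.

Lemma density_le s : 0 < s -> s <= 1 -> density s = s * b 1.
Proof.
move=> s0 s1; rewrite /density max_l ?(ltW s0)//; congr (_ * b _).
by rewrite (@ceil_def _ _ 1)// subrr s0 s1.
Qed.

(** Just to the left of [t], the ceiling is constant and equal to that of [t]. *)
Lemma density_left_continuous t : 0 < t ->
  density s @[s --> t^'-] --> density t.
Proof.
move=> t0; have := ceil_itv t => /andP[ct tc].
apply: (@cvg_trans _ ((fun s => s * b `|Num.ceil t|%N) s @[s --> t^'-])).
  apply: near_eq_cvg; near=> s.
  have s0 : 0 < s by near: s; exact: nbhs_left_gt.
  have st : s < t by near: s; exact: nbhs_left_lt.
  have cs : (Num.ceil t - 1)%:~R < s by near: s; exact: nbhs_left_gt.
  rewrite /density max_l ?(ltW s0)// (@ceil_def _ s (Num.ceil t))// cs /=.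
  exact: le_trans (ltW st) tc.
rewrite /density max_l ?(ltW t0)//; apply: cvgMl; apply: cvg_at_left_filter.
exact: cvg_id.
Unshelve. all: by end_near. Qed.

Lemma measurable_EFin_density (A : set (measurableTypeR R)) : measurable A ->
  measurable_fun A (fun s : measurableTypeR R => (density s)%:E).
Proof.
move=> mA; apply/measurable_EFinP.
exact: (nondecreasing_measurable mA density_nd).
Qed.

Let mitv (i : interval R) : measurable ([set` i] : set (measurableTypeR R)).
Proof. exact: measurable_itv. Qed.

Let I (x : R) : \bar R := (\int[leb]_(s in `[0%R, x]) (density s)%:E)%E.

Lemma integral_density_le x : 0 <= x -> (I x <= (x * density x)%:E)%E.
Proof.
move=> x0.
have -> : ((x * density x)%:E = \int[leb]_(s in `[0%R, x]) (density x)%:E)%E.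
  rewrite integral_cst//= lebesgue_measure_itv /= lte_fin.
  move: x0; rewrite le_eqVlt => /predU1P[<-|x0]; last first.
    by rewrite x0 -EFinB subr0 -EFinM mulrC.
  by rewrite ltxx mul0r mule0.
apply: ge0_le_integral => //.
- by move=> s _; rewrite lee_fin density_ge0.
- exact: measurable_EFin_density.
- by move=> s /=; rewrite in_itv /= lee_fin => /andP[_]; exact: density_nd.
Qed.

Lemma integral_density x : (I x = (density_primitive x)%:E)%E.
Proof.
have [x0|x0] := leP 0 x; last first.
  rewrite /I /density_primitive set_itv_ge ?integral_set0 ?Rintegral_set0//.
  by rewrite bnd_simp -ltNge.
rewrite /density_primitive /Rintegral fineK// ge0_fin_numE.
  exact: le_lt_trans (integral_density_le x0) (ltry _).
by apply: integral_ge0 => s _; rewrite lee_fin density_ge0.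
Qed.

Lemma integral_density_ge x y : 0 <= x -> x <= y ->
  (I x + ((y - x) * density x)%:E <= I y)%E.
Proof.
move=> x0 xy; rewrite /I.
rewrite (@itv_bndbnd_setU _ R (BLeft 0) (BRight x) (BRight y)) ?bnd_simp//.
rewrite ge0_integral_setU//=; last 3 first.
- by apply: measurable_EFin_density; exact: measurableU.
- by move=> s _; rewrite lee_fin density_ge0.
- apply/disj_setPS => s [] /=; rewrite !in_itv /= => /andP[_ sx] /andP[xs _].
  by move: (le_lt_trans sx xs); rewrite ltxx.
apply: leeD => //.
have -> : (((y - x) * density x)%:E =
    \int[leb]_(s in `]x, y]) (density x)%:E)%E.
  rewrite integral_cst//= lebesgue_measure_itv /= lte_fin.
  move: xy; rewrite le_eqVlt => /predU1P[<-|xy]; last first.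
    by rewrite xy -EFinD -EFinM mulrC.
  by rewrite ltxx subrr mul0r mule0.
apply: ge0_le_integral => //.
- by move=> s _; rewrite lee_fin density_ge0.
- exact: measurable_EFin_density.
- move=> s /=; rewrite in_itv /= lee_fin => /andP[xs _].
  exact/density_nd/ltW.
Qed.

Local Notation Phi := density_primitive.

Lemma primitive_ge0 x : 0 <= Phi x.
Proof. by apply: Rintegral_ge0 => s _; exact: density_ge0. Qed.

Lemma primitive_le x : 0 <= x -> Phi x <= x * density x.
Proof.
by move=> x0; rewrite -lee_fin -integral_density integral_density_le.
Qed.

Lemma primitive_ge x y : 0 <= x -> x <= y ->
  Phi x + (y - x) * density x <= Phi y.
Proof.
move=> x0 xy; rewrite -lee_fin EFinD -!integral_density.
exact: integral_density_ge.
Qed.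

Lemma primitive_nd : {homo Phi : x y / x <= y}.
Proof.
move=> x y xy; have [x0|x0] := leP 0 x.
  apply: le_trans (primitive_ge x0 xy).
  by rewrite lerDl mulr_ge0 ?subr_ge0 ?density_ge0.
rewrite [leLHS](_ : _ = 0) ?primitive_ge0//.
by rewrite /density_primitive set_itv_ge ?Rintegral_set0// bnd_simp -ltNge.
Qed.

Lemma primitive_half_ge x : 0 <= x -> x / 2 * density (x / 2) <= Phi x.
Proof.
move=> x0; have x2 : 0 <= x / 2 by rewrite divr_ge0.
have xx : x / 2 <= x by lra.
have := primitive_ge x2 xx; have := primitive_ge0 (x / 2).
by rewrite (_ : x - x / 2 = x / 2); lra.
Qed.

Lemma primitive_half x : 0 <= x -> 2 * Phi (x / 2) <= Phi x.
Proof.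
move=> x0; have x2 : 0 <= x / 2 by rewrite divr_ge0.
have xx : x / 2 <= x by lra.
have := primitive_ge x2 xx; have := primitive_le x2.
by rewrite (_ : x - x / 2 = x / 2); lra.
Qed.

Lemma primitive_sqr x : 0 <= x -> x ^+ 2 / 4 <= Phi x.
Proof.
move=> x0; apply: le_trans (primitive_half_ge x0).
have x2 : 0 <= x / 2 by rewrite divr_ge0.
rewrite (_ : x ^+ 2 / 4 = x / 2 * (x / 2)); last by field.
by rewrite ler_wpM2l// density_ge.
Qed.

Lemma primitive_N_function : N_function Phi.
Proof.
split.
- exists (EFin \o density); split.
  + by move=> s _; rewrite lee_fin density_ge0.
  + by move=> s t _ st; rewrite lee_fin density_nd.
  + move=> t t0; apply: cvg_EFin; first exact: nearW.
    exact: density_left_continuous.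
  + split.
    * move=> /(_ 1 ler01) [] /eqP; rewrite gt_eqF//.
      exact: lt_le_trans ltr01 (density_ge 1).
    * by move=> /(_ 0 (lexx _)).
    * by move=> t _; rewrite /= -integral_density.
- apply: (@squeeze_cvgr _ _ _ _ (cst 0) (fun x => x * b 1)).
  + near=> x.
    have x0 : 0 < x by near: x; exact: nbhs_right_gt.
    have x1 : x <= 1 by near: x; exact: nbhs_right_le.
    rewrite /= divr_ge0 ?primitive_ge0 ?(ltW x0)//= -density_le//.
    by rewrite ler_pdivrMr// mulrC primitive_le// ltW.
  + exact: cvg_cst.
  + rewrite -[X in _ --> X](mul0r (b 1)); apply: cvgMl.
    by apply: cvg_at_right_filter; exact: cvg_id.
- apply/cvgrPdist_lt => e e0; near=> x.
  have x0 : 0 < x by near: x; apply: nbhs_pinfty_gt; rewrite num_real.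
  have xe : 4 / e < x by near: x; apply: nbhs_pinfty_gt; rewrite num_real.
  have P0 : 0 < Phi x.
    apply: lt_le_trans (primitive_sqr (ltW x0)).
    by rewrite divr_gt0// exprn_gt0.
  rewrite sub0r normrN ger0_norm ?divr_ge0 ?ltW// ltr_pdivrMr//.
  apply: lt_le_trans (_ : e * (x ^+ 2 / 4) <= _); last first.
    by rewrite ler_pM2l// primitive_sqr// ltW.
  move: xe; rewrite ltr_pdivrMr// => xe; nra.
Unshelve. all: by end_near. Qed.

End FastNFunction.

(** N-functions may grow arbitrarily fast along the powers of 2. *)
Lemma fast_N_function (R : realType) (c : nat -> R) : exists Phi : R -> R,
  [/\ N_function Phi, {homo Phi : x y / x <= y},
      (forall n, c n <= Phi (2 ^+ n)),
      (forall x, 0 <= x -> x ^+ 2 / 4 <= Phi x) &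
      (forall x, 0 <= x -> 2 * Phi (x / 2) <= Phi x)].
Proof.
(* Phi (2^n) is at least b m / 4 for m = ceil (2^n / 2), and n <= 2 m. *)
pose b m : R := 1 + \sum_(i < m.*2.+1) 4 * `|c i|.
have b1 m : 1 <= b m by rewrite lerDl sumr_ge0.
have b_nd : {homo b : m n / (m <= n)%N >-> m <= n}.
  move=> m n mn; rewrite lerD2l.
  have mn' : (m.*2.+1 <= n.*2.+1)%N by rewrite ltnS leq_double.
  rewrite (big_ord_widen _ (fun i => 4 * `|c i|) mn').
  rewrite [leRHS](bigID (fun i : 'I__ => (i < m.*2.+1)%N)) /=.
  by rewrite lerDl sumr_ge0.
exists (density_primitive b); split.
- exact: primitive_N_function.
- exact: primitive_nd.
- move=> n; apply: le_trans (primitive_half_ge b1 b_nd _); last first.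
    by rewrite exprn_ge0.
  set x := 2 ^+ n / 2; have x12 : 2^-1 <= x.
    by rewrite ler_pdivlMr// mulVf// exprn_ege1// ler1n.
  have x0 : 0 <= x by lra.
  rewrite /density max_l//; set m := `|_|%N.
  have nm : (n <= m.*2)%N.
    have xm : x <= m%:R.
      rewrite /m; apply: le_trans (ceil_ge x) _.
      by rewrite natr_absz ger0_norm ?ceil_ge0//; lra.
    have : (n < 2 ^ n)%N by exact: ltn_expl.
    have : (2 ^ n <= m.*2)%N.
      by rewrite -(ler_nat R) natrX -mul2n natrM; move: xm; rewrite /x; lra.
    by move=> h1 h2; rewrite ltnW// (leq_trans h2).
  have cb : 4 * c n <= b m.
    have nm' : (n < m.*2.+1)%N by rewrite ltnS.
    rewrite /b (bigD1 (Ordinal nm')) //=.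
    have := ler_norm (c n).
    have : 0 <= \sum_(i < m.*2.+1 | i != Ordinal nm') 4 * `|c i|.
      by rewrite sumr_ge0.
    lra.
  have xx : 4^-1 <= x * x.
    by rewrite (_ : 4^-1 = 2^-1 * 2^-1 :> R); [rewrite ler_pM|field].
  have b0 : 0 <= b m by exact: le_trans ler01 (b1 m).
  by rewrite mulrA; apply: le_trans (ler_wpM2r b0 xx); lra.
- exact: primitive_sqr.
- exact: primitive_half.
Qed.

(** * Functions with small support *)

Lemma ereal_le_max (R : realType) (a b c d : \bar R) :
  a \is a fin_num -> b \is a fin_num -> c \is a fin_num -> d \is a fin_num ->
  (2%:E * (a + b) <= c + d -> a + b <= c \/ a + b <= d)%E.
Proof.
move: a b c d => [a| |] [b| |] [c| |] [d| |] // _ _ _ _.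
rewrite -!EFinD -EFinM !lee_fin => h.
by have [?|?] := leP (a + b) c; [left|right; lra].
Qed.

Lemma lte_natS (R : realType) (n : nat) (e : R) (a b : \bar R) :
  ((n.+1%:R * e)%:E < a -> e%:E < b -> (n.+2%:R * e)%:E < a + b)%E.
Proof.
by move=> na eb; rewrite -[n.+2%:R]natr1 mulrDl mul1r EFinD lteD.
Qed.

Section BoundedTransform.
Variable R : realType.
Local Notation leb := (@lebesgue_measure R).
Local Notation D := (`]0%R, +oo[%classic : set R).
Local Notation H := (@right_half_plane R : set (borelC R)).
Variables (q : R) (mu : {measure set (borelC R) -> \bar R}).
Hypothesis q2 : 2 <= q.
Implicit Types (f g : R -> R[i]) (M : R).

(** Measurable functions on the half line whose modulus is at most [M]. *)
Definition bounded_by M f :=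
  measurable_fun D (f : R -> borelC R) /\ forall t, D t -> cabs (f t) <= M.

Lemma bounded_by_Linfty M f : 0 <= M -> bounded_by M f ->
  Lp_space leb D +oo%E f /\ (Lp_norm leb D +oo%E f <= M%:E)%E.
Proof.
move=> M0 [mf fM].
suff N : (Lp_norm leb D +oo%E f <= M%:E)%E.
  by split => //; split => //; apply: le_lt_trans N (ltry _).
rewrite /Lp_norm unlock; case: ifPn => [_|_]; last by rewrite lee_fin.
apply/ess_sup_inf.ess_supP; apply: aeW => t /=.
rewrite patchE; case: ifPn => [/set_mem Dt|_].
  by rewrite /= lee_fin ger0_norm ?cabs_ge0 ?fM.
by rewrite abse0 lee_fin.
Qed.

Let mH := @measurable_right_half_plane R.
Let mD := @measurable_half_line R.
Let q0 : 0 < q. Proof. by apply: lt_le_trans q2. Qed.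

(** The q-th power of the norm of the Laplace transform of [f] in L^q. *)
Definition energy f := (\int[mu]_(z in H) (cabs (laplace f z) `^ q)%:E)%E.

Variable C : R.
Hypothesis C0 : 0 <= C.

(** The form in which the boundedness of the transform on L^oo is used. *)
Hypothesis bounded_laplace : forall M f, 0 <= M -> bounded_by M f ->
  [/\ forall z, H z -> laplace_convergent f z,
      measurable_fun H (laplace f : borelC R -> borelC R) &
      (Lp_norm mu H q%:E (laplace f) <= (C * M)%:E)%E].

Lemma energy_le M f : 0 <= M -> bounded_by M f ->
  (energy f <= ((C * M) `^ q)%:E)%E.
Proof.
move=> M0 bf; have [_ _] := bounded_laplace M0 bf.
by rewrite Lp_norm_le ?mulr_ge0.
Qed.

Lemma energy_fin M f : 0 <= M -> bounded_by M f -> energy f \is a fin_num.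
Proof.
move=> M0 bf; rewrite ge0_fin_numE; last first.
  by apply: integral_ge0 => z _; rewrite lee_fin powR_ge0.
exact: le_lt_trans (energy_le M0 bf) (ltry _).
Qed.

Lemma bounded_by0 : bounded_by 1 (fun=> 0).
Proof.
by split => [|t _]; [exact: measurable_cst|rewrite cabs0].
Qed.

Lemma bounded_by_splice M (A : set R) f g : measurable A ->
  bounded_by M g -> bounded_by M f -> bounded_by M (splice A g f).
Proof.
move=> mA [mg gM] [mf fM]; split; first exact: measurable_splice.
by move=> t Dt; rewrite /splice; case: ifPn => _; [exact: gM|exact: fM].
Qed.

Lemma bounded_by_scale M (k : R) f : bounded_by M f ->
  bounded_by (`|k| * M) (fun t => (k%:C)%C * f t).
Proof.
move=> [mf fM]; split; first exact: measurable_fun_scaleC.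
by move=> t Dt; rewrite cabsM cabs_real ler_wpM2l// fM.
Qed.

(** Clarkson's inequality, integrated. *)
Lemma energy_parallelogram f g hp hm : bounded_by 1 f -> bounded_by 1 g ->
  bounded_by 1 hp -> bounded_by 1 hm ->
  (forall z, H z -> laplace hp z = laplace f z + laplace g z) ->
  (forall z, H z -> laplace hm z = laplace f z - laplace g z) ->
  (2%:E * (energy f + energy g) <= energy hp + energy hm)%E.
Proof.
move=> bf bg bp bm Lp Lm.
have mL u : bounded_by 1 u ->
    measurable_fun H (laplace u : borelC R -> borelC R).
  by move=> /(bounded_laplace ler01)[].
exact: (clarkson_Lp mu mH q2 (mL _ bf) (mL _ bg) (mL _ bp) (mL _ bm) Lp Lm).
Qed.

(** If [g] vanishes off [A], then replacing [f] on [A] by either [g] or [- g]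
    gives a function with at least the sum of the energies of [g] and of [f]
    restricted to the complement of [A]. *)
Lemma energy_splice (A : set R) f g (f0 := splice A (fun=> 0) f) :
  measurable A ->
  bounded_by 1 f -> bounded_by 1 g -> (forall t, D t -> ~ A t -> g t = 0) ->
  exists2 h, bounded_by 1 h /\ (forall t, ~ A t -> h t = f t) &
    (energy f0 + energy g <= energy h)%E.
Proof.
move=> mA bf bg gA; pose gN t := ((-1 : R)%:C)%C * g t.
have bgN : bounded_by 1 gN.
  by have := bounded_by_scale (-1) bg; rewrite normrN1 mul1r.
have bf0 : bounded_by 1 f0 by exact: (bounded_by_splice mA bounded_by0).
pose hp := splice A g f; pose hm := splice A gN f.
have bp : bounded_by 1 hp by exact: bounded_by_splice.
have bm : bounded_by 1 hm by exact: bounded_by_splice.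
have [cf0 mf0 _] := bounded_laplace ler01 bf0.
have [cg mg _] := bounded_laplace ler01 bg.
have [cgN _ _] := bounded_laplace ler01 bgN.
have [_ mhp _] := bounded_laplace ler01 bp.
have [_ mhm _] := bounded_laplace ler01 bm.
have Lp z : H z -> laplace hp z = laplace f0 z + laplace g z.
  move=> Hz; rewrite -laplaceD; [|exact: cf0|exact: cg].
  apply: eq_laplace => t Dt; rewrite /hp /f0 /splice.
  case: ifPn => [_|/negP nA]; first by rewrite add0r.
  by rewrite gA ?addr0// => At; apply: nA; exact: mem_set.
have Lm z : H z -> laplace hm z = laplace f0 z - laplace g z.
  move=> Hz; have -> : - laplace g z = laplace gN z.
    by rewrite laplaceZ; [rewrite rmorphN1 mulN1r|exact: cg].
  rewrite -laplaceD; [|exact: cf0|exact: cgN].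
  apply: eq_laplace => t Dt; rewrite /hm /f0 /splice.
  case: ifPn => [_|/negP nA]; first by rewrite add0r.
  by rewrite /gN gA ?mulr0 ?addr0// => At; apply: nA; exact: mem_set.
have sum := energy_parallelogram bf0 bg bp bm Lp Lm.
have fin u : bounded_by 1 u -> energy u \is a fin_num by exact: energy_fin.
have [le_p|le_m] :=
    ereal_le_max (fin _ bf0) (fin _ bg) (fin _ bp) (fin _ bm) sum.
  exists hp => //; split => // t At; rewrite /hp /splice ifN//.
  by apply/negP => /set_mem.
exists hm => //; split => // t At; rewrite /hm /splice ifN//.
by apply/negP => /set_mem.
Qed.

(** Replacing [f] by 0 on any set of small enough measure keeps the energy
    above a given [c < energy f]. *)
Lemma energy_remove f (c : \bar R) : bounded_by 1 f -> (c < energy f)%E ->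
  exists2 e : R, 0 < e & forall A : set R, measurable A -> (leb A <= e%:E)%E ->
    (c < energy (splice A (fun=> 0%R) f))%E.
Proof.
move=> bf cf; apply: contrapT => nE.
have hA n : {A : set R | [/\ measurable A, (leb A <= (n.+1%:R^-1)%:E)%E &
    (energy (splice A (fun=> 0%R) f) <= c)%E]}.
  apply: cid; apply: contrapT => nA; apply: nE; exists n.+1%:R^-1.
    by rewrite invr_gt0.
  move=> A mA An; rewrite ltNge; apply/negP => cA; apply: nA.
  by exists A.
pose A n := sval (hA n); pose F n := splice (A n) (fun=> 0) f.
have mA n : measurable (A n) by rewrite /A; case: (hA n) => ? [].
have bF n : bounded_by 1 (F n) by exact: bounded_by_splice bounded_by0 bf.
(* The transforms of the functions F n converge pointwise to that of f, since
   the sets A n have vanishing measure. *)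
move: cf; apply/negP; rewrite -leNgt.
apply: (fatou_Lp mH q0 (f_ := fun n => laplace (F n))).
- by move=> n; have [] := bounded_laplace ler01 (bF n).
- move=> z Hz.
  have [cf _ _] := bounded_laplace ler01 bf.
  have bound n : cabs (laplace f z - laplace (F n) z) <= 2 * n.+1%:R^-1.
    pose G := splice (A n) f (fun=> 0).
    have bG : bounded_by 1 G by exact: bounded_by_splice bf bounded_by0.
    have [cG _ _] := bounded_laplace ler01 bG.
    have [cF _ _] := bounded_laplace ler01 (bF n).
    have -> : laplace f z = laplace (F n) z + laplace G z.
      rewrite -laplaceD; [|exact: cF|exact: cG].
      apply: eq_laplace => t Dt; rewrite /F /G /splice.
      by case: ifPn; rewrite ?add0r ?addr0.
    rewrite addrC addKr.
    apply: (@cabs_laplace_small_support _ (A n)) => //.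
    + by rewrite /A; case: (hA n) => ? [].
    + exact: cG.
    + by case: bG.
    + move=> t Dt At; rewrite /G /splice ifN//.
      by apply/negP => /set_mem.
  apply: (@squeeze_cvgr _ _ _ _ (cst 0) (fun n => 2 * n.+1%:R^-1)).
  + by apply: nearW => n; rewrite /= cabs_ge0 bound.
  + exact: cvg_cst.
  + rewrite -[X in _ --> X](mulr0 2); apply: cvgMr; exact: cvg_harmonic.
- by move=> n; rewrite -/(energy _) /F /A; case: (hA n) => ? [].
Qed.

(** Functions bounded by 1 have uniformly small energies when their supports
    have small measure; otherwise, energies could be added up beyond the bound
    imposed by boundedness on L^oo. *)
Lemma small_support (e : R) : 0 < e ->
  exists2 r : R, 0 < r & forall (f : R -> R[i]) (A : set R), measurable A ->
    (leb A <= r%:E)%E -> bounded_by 1 f ->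
    (forall t, D t -> ~ A t -> f t = 0) -> (energy f <= e%:E)%E.
Proof.
move=> e0; apply: contrapT => nS.
have step0 (r : R) : 0 < r -> exists f (A : set R), [/\ measurable A,
    (leb A <= r%:E)%E, bounded_by 1 f,
    (forall t, D t -> ~ A t -> f t = 0) & (e%:E < energy f)%E].
  move=> r0; apply: contrapT => nf; apply: nS; exists r => // f A mA Ar bf fA.
  rewrite leNgt; apply/negP => ef; apply: nf; by exists f, A.
(* The energy n.+1 * e is reached with arbitrarily small supports. *)
have stepn n (r : R) : 0 < r -> exists f (A : set R), [/\ measurable A,
    (leb A <= r%:E)%E, bounded_by 1 f,
    (forall t, D t -> ~ A t -> f t = 0) & ((n.+1%:R * e)%:E < energy f)%E].
  elim: n r => [|n IH] r r0; first by rewrite mul1r; exact: step0.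
  have r2 : 0 < r / 2 by rewrite divr_gt0.
  have [f [A [mA Ar bf fA ef]]] := IH _ r2.
  have [d d0 hd] := energy_remove bf ef.
  have m0 : 0 < Num.min (r / 2) d by rewrite lt_min r2 d0.
  have [g [B [mB Br bg gB eg]]] := step0 _ m0.
  have [h [bh hf] eh] := energy_splice mB bf bg gB.
  exists h, (A `|` B); split.
  - exact: measurableU.
  - have mA' : measurable (A : set (measurableTypeR R)) by exact: mA.
    have mB' : measurable (B : set (measurableTypeR R)) by exact: mB.
    apply: (le_trans (measureU2 leb mA' mB')).
    rewrite [in leRHS](splitr r) EFinD leeD//.
    by apply: le_trans Br _; rewrite lee_fin ge_min lexx.
  - exact: bh.
  - by move=> t Dt /not_orP [At Bt]; rewrite hf// fA.
  apply: (lt_le_trans (lte_natS _ eg) eh); apply: hd => //.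
  by apply: le_trans Br _; rewrite lee_fin ge_min lexx orbT.
have [N NC] : exists N : nat, (C * 1) `^ q <= N.+1%:R * e.
  exists (Num.truncn ((C * 1) `^ q / e)); rewrite -ler_pdivrMr//.
  by apply/ltW; exact: truncnS_gt.
have [f [A [_ _ bf _]]] := stepn N _ ltr01.
rewrite ltNge => /negP; apply; apply: le_trans (energy_le ler01 bf) _.
by rewrite lee_fin.
Qed.

(** * From bounded functions to an Orlicz space *)

(** This exponential is the integrand of the transform of the constant function
    1 at [a], so its integrability is part of the boundedness on L^oo. *)
Lemma integrable_expR_half_line (a : R) : 0 < a ->
  leb.-integrable D (EFin \o (fun t => expR (- (a * t)))).
Proof.
move=> a0; have b1 : bounded_by 1 (fun _ : R => (1 : R[i])).
  by split=> [|t _]; [exact: measurable_cst|rewrite /cabs normr1].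
have [cv _ _] := bounded_laplace ler01 b1.
have [+ _] := cv (a%:C)%C a0.
apply: (eq_integrable mD) => t _.
by rewrite laplace_kernelE /= mul0r oppr0 cos0 sin0 !mul0r !mul1r !subr0 mulr1.
Qed.

(** What is required of [Phi]: supports of measure at most [r n] force norms
    of transforms at most [4^-(n+1)], and [1 / r n <= Phi (2^n)] gives the set
    where [|f| > 2^n] a measure at most [r n] as soon as the integral of
    [Phi |f|] is at most 1.  The quadratic lower bound makes the transform
    converge. *)
Variable Phi : R -> R.
Hypothesis Phi_nd : {homo Phi : x y / x <= y}.
Hypothesis Phi_sqr : forall x, 0 <= x -> x ^+ 2 / 4 <= Phi x.
Variable r : nat -> R.
Hypothesis r0 : forall n, 0 < r n.
Hypothesis Phi_r : forall n, (r n)^-1 <= Phi (2 ^+ n).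
Hypothesis small : forall n f (A : set R), measurable A ->
  (leb A <= (r n)%:E)%E -> bounded_by 1 f ->
  (forall t, D t -> ~ A t -> f t = 0) ->
  (energy f <= ((4^-1 ^+ n.+1) `^ q)%:E)%E.

Lemma Phi_ge0 x : 0 <= x -> 0 <= Phi x.
Proof.
by move=> x0; apply: le_trans (Phi_sqr x0); rewrite divr_ge0 ?sqr_ge0.
Qed.

Lemma measurable_Phi_cabs f : measurable_fun D (f : R -> borelC R) ->
  measurable_fun (D : set (measurableTypeR R)) (fun t => (Phi (cabs (f t)))%:E).
Proof.
move=> mf; apply/measurable_EFinP.
have mPhi : measurable_fun setT Phi by exact: nondecreasing_measurable.
exact: (measurableT_comp mPhi (measurable_fun_cabs mf)).
Qed.

Section Unit.
Variable f : R -> R[i].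
Hypothesis mf : measurable_fun D (f : R -> borelC R).
Hypothesis Phi1 : (\int[leb]_(t in D) (Phi (cabs (f t)))%:E <= 1)%E.

(* Inside D, since f is arbitrary on negative reals. *)
Let A n : set R := D `&` [set t | 2 ^+ n < cabs (f t)].

Let mA n : measurable (A n : set (measurableTypeR R)).
Proof.
have mc := measurable_fun_cabs mf.
rewrite (_ : A n = D `&` (fun t => cabs (f t)) @^-1` `]2 ^+ n, +oo[%classic).
  by apply: mc => //; exact: measurable_itv.
by apply/seteqP; split => t; rewrite /A /= !in_itv /= !andbT.
Qed.

(* Markov's inequality. *)
Let leb_A n : (leb (A n) <= (r n)%:E)%E.
Proof.
have P0 t : (0 <= (Phi (cabs (f t)))%:E)%E by rewrite lee_fin Phi_ge0 ?cabs_ge0.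
have : (((r n)^-1)%:E * leb (A n) <= 1)%E.
  apply: le_trans Phi1; rewrite -(integral_cst leb (mA n)).
  apply: (@le_trans _ _ (\int[leb]_(t in A n) (Phi (cabs (f t)))%:E)%E).
    apply: ge0_le_integral => //.
    - by move=> t _; rewrite lee_fin invr_ge0 ltW.
    - exact: (measurable_funS mD (@subIsetl _ _ _) (measurable_Phi_cabs mf)).
    - move=> t [_ /= ft]; rewrite lee_fin; apply: le_trans (Phi_r n) _.
      exact/Phi_nd/ltW.
  apply: ge0_subset_integral => //.
    exact: measurable_Phi_cabs.
  exact: subIsetl.
by rewrite lee_pdivrMl// mule1.
Qed.

(* The truncation of f, replaced by 0 where its modulus exceeds 2^n. *)
Let F n := splice (A n) (fun=> 0) f.

Let F_bounded n : bounded_by (2 ^+ n) (F n).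
Proof.
split.
  by apply: (measurable_splice (mA n) _ mf); exact: measurable_cst.
move=> t Dt; rewrite /F /splice; case: ifPn => [_|/negP tA].
  by rewrite cabs0 exprn_ge0.
by rewrite leNgt; apply/negP => ft; apply: tA; rewrite mem_set.
Qed.

Let F_convergent n z : H z -> laplace_convergent (F n) z.
Proof.
move=> Hz.
have [cv _ _] := bounded_laplace (exprn_ge0 n (ler0n R 2)) (F_bounded n).
exact: cv.
Qed.

Let mF n : measurable_fun H (laplace (F n) : borelC R -> borelC R).
Proof.
by have [_ ? _] := bounded_laplace (exprn_ge0 n (ler0n R 2)) (F_bounded n).
Qed.

(* The part of f with values of modulus in (2^n, 2^(n+1)]. *)
Let slice n := splice (A n) (F n.+1) (fun=> 0).

Let F_slice n t : F n.+1 t = F n t + slice n t.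
Proof.
rewrite /slice {2}/F /splice; case: ifPn => [_|/negP tA].
  by rewrite add0r.
rewrite addr0 /F /splice ifN//; apply/negP => /set_mem [Dt /= ft].
apply: tA; apply: mem_set; split => //=; apply: le_lt_trans ft.
by rewrite ler_eXn2l ?ltr1n.
Qed.

Let slice_norm n :
  [/\ forall z, H z -> laplace_convergent (slice n) z,
      measurable_fun H (laplace (slice n) : borelC R -> borelC R) &
      (Lp_norm mu H q%:E (laplace (slice n)) <= (2^-1 ^+ n.+1)%:E)%E].
Proof.
have p20 : 0 <= 2 ^+ n.+1 :> R by rewrite exprn_ge0.
have bs : bounded_by (2 ^+ n.+1) (slice n).
  apply: (bounded_by_splice (mA n) (F_bounded n.+1)).
  by split => [|t _]; [exact: measurable_cst|rewrite cabs0].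
have [cs ms _] := bounded_laplace p20 bs.
split => //.
pose g t := ((2^-1 ^+ n.+1)%:C)%C * slice n t.
have bg : bounded_by 1 g.
  have := bounded_by_scale (2^-1 ^+ n.+1) bs.
  by rewrite ger0_norm ?exprn_ge0// -exprMn mulVf// expr1n.
have [cg mg _] := bounded_laplace ler01 bg.
have gA t : D t -> ~ A n t -> g t = 0.
  move=> _ tA; rewrite /g /slice /splice ifN ?mulr0//.
  by apply/negP => /set_mem.
have Ng : (Lp_norm mu H q%:E (laplace g) <= (4^-1 ^+ n.+1)%:E)%E.
  rewrite Lp_norm_le ?exprn_ge0//; exact: small (mA n) (leb_A n) bg gA.
have -> : 2^-1 ^+ n.+1 = 2 ^+ n.+1 * 4^-1 ^+ n.+1 :> R.
  by rewrite -exprMn; congr (_ ^+ _); field.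
apply: (Lp_norm_scale_le mH q0 p20 _ mg ms _ Ng); first by rewrite exprn_ge0.
move=> z Hz; rewrite laplaceZ; last exact: cs.
rewrite cabsM cabs_real ger0_norm ?exprn_ge0// mulrA -exprMn divff// expr1n.
by rewrite mul1r.
Qed.

(* The bound C for the truncation at height 1, plus the sum of 2^-(i+1) over
   i < n. *)
Let F_norm n : (Lp_norm mu H q%:E (laplace (F n)) <= (C + 1 - 2^-1 ^+ n)%:E)%E.
Proof.
elim: n => [|n IH].
  have [_ _] := bounded_laplace (exprn_ge0 0 (ler0n R 2)) (F_bounded 0).
  by rewrite !expr0 mulr1 addrK.
have [cs ms Ns] := slice_norm n.
have q1 : 1 <= q by apply: le_trans q2; rewrite ler1n.
apply: le_trans (Lp_norm_triangle mu mH q1 (mF n.+1) (mF n) ms _) _.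
  move=> z Hz.
  rewrite -[laplace (F n.+1) z](_ :
    laplace (F n) z + laplace (slice n) z = _).
    exact: cabsD.
  rewrite -laplaceD; [|exact: F_convergent|exact: cs].
  by apply: eq_laplace => t _; rewrite F_slice.
apply: le_trans (leeD IH Ns) _; rewrite -EFinD lee_fin.
have -> : 2^-1 ^+ n = 2 * 2^-1 ^+ n.+1 :> R.
  by rewrite exprS mulrA divff// mul1r.
lra.
Qed.

(* An integrable majorant of the kernels of f and of its truncations. *)
Let dominating (z : R[i]) t :=
  expR (- (complex.Re z * t)) + 4 * Phi (cabs (f t)).

Let integrable_dominating z : H z -> leb.-integrable D (EFin \o dominating z).
Proof.
move=> Hz.
have iP : leb.-integrable D (fun t => (Phi (cabs (f t)))%:E).
  apply/integrableP; split; first exact: measurable_Phi_cabs.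
  apply: le_lt_trans (ltry 1); apply: le_trans Phi1.
  apply: ge0_le_integral => //.
  - by apply: measurableT_comp => //; exact: measurable_Phi_cabs.
  - exact: measurable_Phi_cabs.
  - by move=> t _ /=; rewrite ger0_norm ?Phi_ge0 ?cabs_ge0.
exact: (eq_integrable mD _ _ _ (integrableD mD
  (integrable_expR_half_line Hz) (integrableZl mD 4 iP))).
Qed.

(* Where |f| > 1, the bound |f| <= |f|^2 <= 4 Phi |f| is used. *)
Let kernel_dominated g z t : H z -> D t -> cabs (g t) <= cabs (f t) ->
  cabs (laplace_kernel g z t) <= dominating z t.
Proof.
move=> Hz Dt gf; have t0 : 0 < t by move: Dt; rewrite /= in_itv /= andbT.
rewrite /dominating; have P0 := Phi_ge0 (cabs_ge0 (f t)).
have [f1|f1] := leP (cabs (f t)) 1.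
  rewrite cabs_laplace_kernel -[leLHS]addr0 lerD ?mulr_ge0//.
  by rewrite ler_piMr ?expR_ge0// (le_trans gf).
apply: le_trans (cabs_laplace_kernel_le g Hz t0) _.
apply: le_trans gf _; rewrite -[leLHS]add0r lerD ?expR_ge0//.
have := Phi_sqr (cabs_ge0 (f t)); nra.
Qed.

(** The transform maps the unit ball of the Orlicz space to a bounded set. *)
Lemma laplace_Orlicz_unit :
  [/\ forall z, H z -> laplace_convergent f z,
      measurable_fun H (laplace f : borelC R -> borelC R) &
      (Lp_norm mu H q%:E (laplace f) <= (C + 1)%:E)%E].
Proof.
have cv z : H z ->
    cabs (laplace f z - laplace (F n) z) @[n --> \oo] --> (0 : R).
  move=> Hz; apply: (cintegral_dominated_cvg mD (h := dominating z)).
  - by move=> n; apply: measurable_laplace_kernel; case: (F_bounded n).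
  - by have [] := measurable_laplace_kernel z mf.
  - by have [] := measurable_laplace_kernel z mf.
  - move=> t Dt; pose N := Num.truncn (cabs (f t)).
    exists N => // n /= Nn; rewrite /laplace_kernel /F /splice ifN//.
    apply/negP => /set_mem [_ /=]; apply/negP; rewrite -leNgt.
    apply: le_trans (ltW (truncnS_gt _)) _.
    by rewrite -natrX ler_nat (leq_trans _ (ltn_expl n (ltnSn 1)))// ltnS.
  - exact: integrable_dominating.
  - move=> n t Dt; apply: kernel_dominated => //.
    by rewrite /F /splice; case: ifPn => _ //; rewrite cabs0 cabs_ge0.
split.
- move=> z Hz; have [mr mi] := measurable_laplace_kernel z mf.
  apply: (cintegrable_le mD mr mi (integrable_dominating Hz)) => t Dt.
  exact: kernel_dominated.
- exact: (measurable_fun_limC mH mF cv).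
- rewrite Lp_norm_le ?addr_ge0//.
  apply: (fatou_Lp mH q0 mF cv) => n.
  rewrite -Lp_norm_le ?addr_ge0//; apply: le_trans (F_norm n) _.
  by rewrite lee_fin lerBlDr lerDl exprn_ge0.
Qed.

End Unit.

Hypothesis Phi_half : forall x, 0 <= x -> 2 * Phi (x / 2) <= Phi x.

(** A weak form of convexity that is enough to rescale into the unit ball. *)
Lemma Phi_half_iter n x : 0 <= x -> 2 ^+ n * Phi (2^-1 ^+ n * x) <= Phi x.
Proof.
elim: n x => [|n IH] x x0; first by rewrite !expr0 !mul1r.
have y0 : 0 <= 2^-1 ^+ n * x by rewrite mulr_ge0 ?exprn_ge0.
apply: le_trans (IH x x0).
rewrite exprSr -mulrA ler_wpM2l ?exprn_ge0//.
by have := Phi_half y0; rewrite exprS (mulrC _ 2^-1) mulrA.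
Qed.

Lemma Luxemburg_unit_exists f : Orlicz_space (EFin \o Phi) `]0, +oo[ f ->
  exists2 k : R, 0 < k &
    (\int[leb]_(t in D) (Phi (k^-1 * cabs (f t)))%:E <= 1)%E.
Proof.
move=> [mf [k k0 ik]].
have mk : measurable_fun D ((fun t => ((k^-1)%:C)%C * f t) : R -> borelC R).
  exact: measurable_fun_scaleC.
have ck (c : R) t : 0 <= c -> cabs ((c%:C)%C * f t) = c * cabs (f t).
  by move=> c0; rewrite cabsM cabs_real ger0_norm.
have P0 (c : R) t : 0 <= c -> (0 <= (Phi (c * cabs (f t)))%:E)%E.
  by move=> c0; rewrite lee_fin Phi_ge0// mulr_ge0 ?cabs_ge0.
have kV : 0 <= k^-1 by rewrite invr_ge0 ltW.
have mPhi (c : R) : 0 <= c -> measurable_fun (D : set (measurableTypeR R))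
    (fun t => (Phi (c * cabs (f t)))%:E).
  move=> c0; have := measurable_Phi_cabs (measurable_fun_scaleC (c%:C)%C mf).
  by apply: eq_measurable_fun => t _; rewrite ck.
have If : (\int[leb]_(t in D) (Phi (k^-1 * cabs (f t)))%:E)%E \is a fin_num.
  exact: (integrable_fin_num mD ik).
set M := fine (\int[leb]_(t in D) (Phi (k^-1 * cabs (f t)))%:E)%E.
pose n := Num.truncn M; pose e : R := 2^-1 ^+ n.+1.
have e0 : 0 < e by rewrite exprn_gt0.
have e2 : 2 ^+ n.+1 * e = 1 by rewrite -exprMn divff// expr1n.
exists (k / e); first by rewrite divr_gt0.
rewrite invf_div.
have ek : 0 <= e / k by rewrite divr_ge0// ltW.
apply: (@le_trans _ _
    (e%:E * \int[leb]_(t in D) (Phi (k^-1 * cabs (f t)))%:E)%E).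
  rewrite -(ge0_integralZl leb mD)//; last 3 first.
  - exact: mPhi.
  - by move=> t _; exact: P0.
  - by rewrite lee_fin ltW.
  apply: ge0_le_integral => //.
  - by move=> t _; exact: P0.
  - exact: mPhi.
  - by apply: measurable_funeM; exact: mPhi.
  move=> t _; rewrite -EFinM lee_fin -mulrA.
  have x0 : 0 <= k^-1 * cabs (f t) by rewrite mulr_ge0 ?cabs_ge0.
  have := Phi_half_iter n.+1 x0; rewrite -/e => h.
  have := ler_wpM2l (ltW e0) h.
  by rewrite [leLHS]mulrA [X in X * _]mulrC e2 mul1r.
rewrite -(fineK If) -EFinM lee_fin -/M.
rewrite -e2 mulrC ler_wpM2r ?(ltW e0)//.
apply: le_trans (ltW (truncnS_gt M)) _.
by rewrite -natrX ler_nat ltnW// ltn_expl.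
Qed.

Lemma laplace_bounded_Orlicz :
  laplace_bounded (Orlicz_space (EFin \o Phi) `]0, +oo[)
    (Luxemburg_norm (EFin \o Phi) `]0, +oo[) mu q.
Proof.
have C1 : 0 < C + 1 by rewrite ltr_wpDl.
exists (C + 1); first exact: ltW.
move=> f Xf; have mf : measurable_fun D (f : R -> borelC R) by case: Xf.
have scaled k : 0 < k ->
    (\int[leb]_(t in D) (Phi (k^-1 * cabs (f t)))%:E <= 1)%E ->
    [/\ forall z, H z -> laplace_convergent f z,
      measurable_fun H (laplace f : borelC R -> borelC R) &
      (Lp_norm mu H q%:E (laplace f) <= (k * (C + 1))%:E)%E].
  move=> k0 fk; pose g t := ((k^-1)%:C)%C * f t.
  have mg : measurable_fun D (g : R -> borelC R).
    exact: measurable_fun_scaleC.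
  have g1 : (\int[leb]_(t in D) (Phi (cabs (g t)))%:E <= 1)%E.
    apply: le_trans fk; under eq_integral do
      rewrite /g cabsM cabs_real ger0_norm ?invr_ge0 ?(ltW k0)//.
    exact: lexx.
  have [cg mLg Ng] := laplace_Orlicz_unit mg g1.
  have fg t : (k%:C)%C * g t = f t.
    by rewrite /g mulrA -rmorphM divff ?gt_eqF// mul1r.
  have Lf z : H z -> laplace f z = (k%:C)%C * laplace g z.
    move=> Hz; rewrite -laplaceZ; last exact: cg.
    by apply: eq_laplace => t _; rewrite fg.
  have mLf : measurable_fun H (laplace f : borelC R -> borelC R).
    have := measurable_fun_scaleC (k%:C)%C mLg.
    apply: eq_measurable_fun => z /set_mem Hz /=.
    by rewrite Lf.
  split => //.
    move=> z Hz; rewrite (_ : f = fun t => (k%:C)%C * g t).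
      by apply: laplace_convergentZ; exact: cg.
    by apply/funext => t; rewrite fg.
  apply: (Lp_norm_scale_le mH q0 (ltW k0) (ltW C1) mLg mLf _ Ng) => z Hz.
  by rewrite Lf// cabsM cabs_real ger0_norm// ltW.
have [k k0 fk] := Luxemburg_unit_exists Xf.
have [cf mLf Nf] := scaled k k0 fk.
split => //.
  by split => //; exact: le_lt_trans Nf (ltry _).
(* The bound holds for every l admissible in the Luxemburg norm, hence for the
   infimum. *)
rewrite -lee_pdivrMl//; apply: le_ereal_inf_tmp => _ [l [l0 fl] <-].
have [_ _ Nl] := scaled l l0 fl.
by rewrite lee_pdivrMl// -EFinM mulrC.
Qed.

End BoundedTransform.

Theorem theorem2p10 (R : realType) (q : R)
    (mu : {measure set (borelC R) -> \bar R}) :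
  2 <= q ->
  regular_on mu (@right_half_plane R) ->
  laplace_bounded
    (Lp_space (@lebesgue_measure R) `]0, +oo[ +oo%E)
    (Lp_norm (@lebesgue_measure R) `]0, +oo[ +oo%E) mu q ->
  exists Phi : R -> R, N_function Phi /\
    laplace_bounded
      (Orlicz_space (EFin \o Phi) `]0, +oo[)
      (Luxemburg_norm (EFin \o Phi) `]0, +oo[) mu q.
Proof.
move=> q2 _ [C C0 hC].
have bL (M : R) (f : R -> R[i]) : 0 <= M -> bounded_by M f ->
    [/\ forall z, right_half_plane z -> laplace_convergent f z,
      measurable_fun (@right_half_plane R : set (borelC R))
        (laplace f : borelC R -> borelC R) &
      (Lp_norm mu (@right_half_plane R) q%:E (laplace f) <= (C * M)%:E)%E].
  move=> M0 bf; have [Xf NM] := bounded_by_Linfty M0 bf.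
  have [cf [mLf _] Nf] := hC f Xf.
  split => //; apply: le_trans Nf _.
  by rewrite EFinM lee_wpmul2l// lee_fin.
have ss n : {r : R | 0 < r /\
    forall (f : R -> R[i]) (A : set R), measurable A ->
    (lebesgue_measure A <= r%:E)%E -> bounded_by 1 f ->
    (forall t, `]0, +oo[%classic t -> ~ A t -> f t = 0) ->
    (energy q mu f <= ((4^-1 ^+ n.+1) `^ q)%:E)%E}.
  apply: cid.
  have e0 : 0 < (4^-1 ^+ n.+1) `^ q :> R by rewrite powR_gt0 ?exprn_gt0.
  by have [r r0 hr] := small_support q2 C0 bL e0; exists r.
pose r n := sval (ss n).
have r0 n : 0 < r n by rewrite /r; case: (ss n) => ? [].
have hr n := (svalP (ss n)).2.
have [Phi [NPhi Phi_nd Phi_r Phi_sqr Phi_half]] :=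
  fast_N_function (fun n => (r n)^-1).
exists Phi; split => //.
exact: (laplace_bounded_Orlicz q2 C0 bL Phi_nd Phi_sqr r0 Phi_r hr Phi_half).
Qed.
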